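(* Let $G$ be any graph and let $H\in\mathcal{H}$ be a graph with $\chi(H)=\chi_i(H)=\ell$. Then $G[H]$ is $k$-indicated colorable if and only if $G[K_\ell]$ is $k$-indicated colorable. In particular, $\chi_i(G[H])=\chi_i(G[K_\ell])$.
   Context: All graphs are finite, simple and undirected. Indicated coloring game on a graph $G$ with a fixed set of $k$ colors: in each round Ann selects an uncolored vertex and Ben assigns it a color from the set so that the partial coloring stays proper. Ann wins if all vertices get colored; Ben wins if some uncolored vertex has neighbors carrying all $k$ colors (a block vertex). $G$ is $k$-indicated colorable if Ann has a winning strategy with $k$ colors regardless of Ben's play; the indicated chromatic number $\chi_i(G)$ is the least such $k$. $\chi(G)$ is the chromatic number, $K_\ell$ the complete graph on $\ell$ vertices. The lexicographic product $G[H]$ has vertex set $V(G)\times V(H)$, with $(x_1,y_1)\sim(x_2,y_2)$ iff either $x_1=x_2$ and $y_1y_2\in E(H)$, or $x_1x_2\in E(G)$. The family $\mathcal{H}$: a graph $G$ belongs to $\mathcal{H}$ if Ann has a winning strategy using $\chi_i(G)$ colors which she can follow until Ben has used $\chi_i(G)$ colors on the vertices of $G$, and for the remaining vertices she has a way of extending this to a winning strategy using $k$ colors, for any $k\geq\chi_i(G)$. *)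

(* Defs.v *)
From mathcomp Require Import all_boot.
From mathcomp Require Import boolp.

Set Implicit Arguments.
Unset Strict Implicit.
Unset Printing Implicit Defensive.

Record sgraph := SGraph {
  vertex :> finType;
  adj : rel vertex;
  adj_sym : symmetric adj;
  adj_irr : irreflexive adj }.

Definition complete_adj (n : nat) : rel 'I_n := fun i j => i != j.

Lemma complete_adj_sym n : symmetric (@complete_adj n).
Proof. by move=> i j; rewrite /complete_adj eq_sym. Qed.

Lemma complete_adj_irr n : irreflexive (@complete_adj n).
Proof. by move=> i; rewrite /complete_adj eqxx. Qed.

Definition complete_graph (n : nat) : sgraph :=
  SGraph (@complete_adj_sym n) (@complete_adj_irr n).

Definition lex_adj (G H : sgraph) : rel (vertex G * vertex H) :=
  fun p q => ((p.1 == q.1) && adj p.2 q.2) || adj p.1 q.1.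

Lemma lex_adj_sym G H : symmetric (@lex_adj G H).
Proof.
by move=> p q; rewrite /lex_adj eq_sym [adj p.2 _]adj_sym [adj p.1 _]adj_sym.
Qed.

Lemma lex_adj_irr G H : irreflexive (@lex_adj G H).
Proof. by move=> p; rewrite /lex_adj !adj_irr andbF. Qed.

Definition lex_product (G H : sgraph) : sgraph :=
  SGraph (@lex_adj_sym G H) (@lex_adj_irr G H).

Definition colorable (G : sgraph) (k : nat) : bool :=
  [exists f : {ffun G -> 'I_k},
    [forall x : G, forall y : G, adj x y ==> (f x != f y)]].

Lemma colorable_exists (G : sgraph) : exists k, colorable G k.
Proof.
exists #|G|; apply/existsP; exists [ffun x => enum_rank x].
apply/forallP => x; apply/forallP => y; apply/implyP => xy.
rewrite !ffunE; apply: contraTneq xy => /enum_rank_inj ->.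
by rewrite adj_irr.
Qed.

Definition chi (G : sgraph) : nat := ex_minn (colorable_exists G).

Section Game.
Variable G : sgraph.

(* Colors are natural numbers. A history lists the rounds played so far, most
   recent first: (v, a) records that Ann selected v and Ben colored it a. *)
Definition history := seq (G * nat).

Definition uncolored (h : history) (v : G) : bool := v \notin unzip1 h.

Definition colors_used (h : history) : nat := size (undup (unzip2 h)).

(* Ann's choice may depend on the whole history. The option type is there for
   the graph without vertices; winning forbids None as long as some vertex is
   uncolored. *)
Definition strategy := history -> option G.

(* h is a legal history of the game with color set S in which Ann has selected
   all her vertices according to s; Ben's choices are arbitrary legal ones. *)
Fixpoint play (S : seq nat) (s : strategy) (h : history) : bool :=
  if h is (v, a) :: h' then
    [&& play S s h', s h' == Some v, uncolored h' v, a \in S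
      & [forall u : G, adj v u ==> ((u, a) \notin h')]]
  else true.

Definition block_vertex (S : seq nat) (h : history) (v : G) : bool :=
  uncolored h v && all (fun a => [exists u : G, adj v u && ((u, a) \in h)]) S.

(* As long as there is no block vertex Ben can answer, and every round colors
   one more vertex; so this says that all vertices end up colored, whatever Ben
   does. *)
Definition winning (S : seq nat) (s : strategy) : Prop :=
  forall h : history, play S s h -> (exists v, uncolored h v) ->
    (exists2 v, s h = Some v & uncolored h v) /\
    ~ (exists v, block_vertex S h v).

Definition indicated_colorable (k : nat) : Prop :=
  exists s : strategy, winning (iota 0 k) s.

Lemma play_uniq S s h : play S s h -> uniq (unzip1 h).
Proof.
elim: h => //= -[v a] h IH /and5P[ph _ vh _ _] /=.
by rewrite IH // andbT.
Qed.

Lemma indicated_colorable_card : indicated_colorable #|G|.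
Proof.
exists (fun h => [pick v | uncolored h v]) => h ph [w wh]; split.
  by case: pickP => [v vh|/(_ w)]; [exists v | rewrite wh].
case=> v /andP[vh /allP blk].
have sub : {subset iota 0 #|G| <= unzip2 h}.
  by move=> a /blk /existsP[u /andP[_ uh]]; apply/mapP; exists (u, a).
have := uniq_leq_size (iota_uniq 0 #|G|) sub.
rewrite size_iota size_map -(size_map fst h) leqNgt => /negP; apply.
have vu : uniq (v :: unzip1 h) by rewrite /= (play_uniq ph) andbT.
by have := max_card [in v :: unzip1 h]; rewrite (card_uniqP vu).
Qed.

Lemma indicated_colorable_exists : exists k, `[< indicated_colorable k >].
Proof. by exists #|G|; apply/asboolP; exact: indicated_colorable_card. Qed.

Definition chi_i : nat := ex_minn indicated_colorable_exists.

(* The names of the colors are immaterial: a strategy "using n colors" is one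
   that wins for every set of n colors. This way s can be followed literally in
   a game with a larger color set T, whichever colors of T Ben picks first. The
   continuation t may depend on T, but s is the same for all T. *)
Definition family_H : Prop :=
  exists s : strategy,
    (forall S : seq nat, uniq S -> size S = chi_i -> winning S s) /\
    (forall (k : nat) (T : seq nat),
        chi_i <= k -> uniq T -> size T = k ->
      exists t : strategy, winning T t /\
        (forall h : history,
          play T t h -> colors_used h < chi_i -> t h = s h)).

End Game.

(* Main.v *)
Require Import Defs.
From mathcomp Require Import all_boot.
From mathcomp Require Import boolp.

Set Implicit Arguments.
Unset Strict Implicit.
Unset Printing Implicit Defensive.

(** Write l for chi H = chi_i H; a move in G[H] or G[K_l] is local to the copy
    of H or K_l lying over a vertex x of G.

    From G[H] to G[K_l]: fix a proper coloring f of H with l colors. Ann runs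
    her strategy on an imaginary game on G[H] in which every vertex (x, v)
    receives the color of (x, f v). The vertex (x, f v) always has a free color:
    otherwise fewer than l colors are absent from the copies adjacent to x, and
    the imaginary game could not color the copy of H over x.

    From G[K_l] to G[H]: when the strategy on G[K_l] selects (x, i), Ann plays
    in the copy of H over x, following the strategy given by [family_H], until
    Ben uses a color that is new to this copy; that color is then given to
    (x, i). It appears because H needs l colors. Once all of G[K_l] is colored,
    each copy of H carries l colors, and Ann completes the copies one after the
    other, by the extension of the strategy to the colors absent from the
    adjacent copies. *)

(** * Upper bounds for the chromatic number *)

Section Chi.
Variable H : sgraph.

Lemma chi_colorable : colorable H (chi H).
Proof. by rewrite /chi; case: ex_minnP. Qed.

(** Replacing each color by its index in [s] gives a coloring by ordinals below [size s];
    repetitions in [s] only weaken the bound. *)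
Lemma chi_le (T : eqType) (f : H -> T) (s : seq T) :
  (forall v, f v \in s) -> (forall u v, adj u v -> f u != f v) ->
  chi H <= size s.
Proof.
move=> fs fP; rewrite /chi; case: ex_minnP => m _; apply.
have fi v : index (f v) s < size s by rewrite index_mem.
apply/existsP; exists [ffun v => Ordinal (fi v)].
apply/forallP => u; apply/forallP => v; apply/implyP => uv.
rewrite !ffunE; apply: contraNneq (fP u v uv) => -[/(congr1 (nth (f u) s))].
by rewrite !nth_index // => ->.
Qed.

End Chi.

(** * Positions of the game, and winning positions without strategies *)

Section Positions.
Variable G : sgraph.
Implicit Types (S T : seq nat) (h : history G) (v w : G) (a : nat).

Definition legal S h v a :=
  [&& uncolored h v, a \in S & [forall u : G, adj v u ==> ((u, a) \notin h)]].

Fixpoint valid S h :=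
  if h is (v, a) :: h' then valid S h' && legal S h' v a else true.

(** The inductive form replaces strategies by an induction over the game tree. Only the selected
    vertex is required to have a legal color; the absence of block vertices elsewhere follows, since
    they would never get colored. *)
Inductive ann_wins S h : Prop :=
| AnnDone of (forall v, ~~ uncolored h v)
| AnnMove v of uncolored h v & (exists a, legal S h v a)
    & (forall a, legal S h v a -> ann_wins S ((v, a) :: h)).

Lemma uncoloredPn h v : reflect (exists a, (v, a) \in h) (~~ uncolored h v).
Proof.
rewrite negbK; apply: (iffP mapP) => [[[w a] wh ->]|[a vh]]; first by exists a.
by exists (v, a).
Qed.

Lemma mem_colors h v a : (v, a) \in h -> a \in unzip2 h.
Proof. by move=> vh; apply/mapP; exists (v, a). Qed.

Lemma legal_fresh S h v a : uncolored h v -> a \notin unzip2 h ->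
  legal S h v a = (a \in S).
Proof.
move=> vh ah; rewrite /legal vh [[forall u, _]](_ : _ = true) ?andbT //.
by apply/forallP => u; apply/implyP => _; apply: contra ah; exact: mem_colors.
Qed.

Lemma ex_legal S h v : ~~ block_vertex S h v -> uncolored h v ->
  exists a, legal S h v a.
Proof.
rewrite /block_vertex => + vh; rewrite vh /= => /allPn[b bS nb]; exists b.
rewrite /legal vh bS /=; apply/forallP => u; apply/implyP => vu.
by apply: contra nb => uh; apply/existsP; exists u; rewrite vu.
Qed.

Lemma valid_colors S h : valid S h -> {subset unzip2 h <= S}.
Proof.
elim: h => //= -[v a] h IH /andP[/IH hS /and3P[_ aS _]] b /=.
by rewrite inE => /predU1P[->|/hS].
Qed.

Lemma valid_uniq S h : valid S h -> uniq (unzip1 h).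
Proof. by elim: h => //= -[v a] h IH /andP[/IH uh /andP[vh _]] /=; rewrite uh andbT. Qed.

Lemma valid_proper S h v w a b : valid S h ->
  (v, a) \in h -> (w, b) \in h -> adj v w -> a != b.
Proof.
elim: h => //= -[u c] h IH /andP[hv /and3P[_ _ /forallP uP]].
rewrite !inE => /predU1P[[-> ->]|vh] /predU1P[[-> ->]|wh].
- by rewrite adj_irr.
- move=> uw; have /implyP/(_ uw) := uP w.
  by apply: contraNneq => ->.
- rewrite adj_sym => uv; have /implyP/(_ uv) := uP v.
  by apply: contraNneq => <-.
- exact: IH.
Qed.

Lemma play_valid S s h : play S s h -> valid S h.
Proof. by elim: h => //= -[v a] h IH /and3P[/IH-> _]. Qed.

Lemma block_vertex_cons S h v w a : w != v -> block_vertex S h w ->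
  block_vertex S ((v, a) :: h) w.
Proof.
move=> wv /andP[wh /allP blk]; apply/andP; split.
  by rewrite /uncolored inE negb_or wv.
apply/allP => b /blk /existsP[u /andP[wu uh]].
by apply/existsP; exists u; rewrite wu inE uh orbT.
Qed.

(* A block vertex stays uncolored, whereas a winning game colors everything. *)
Lemma ann_wins_no_block S h w : ann_wins S h -> ~~ block_vertex S h w.
Proof.
move=> win; elim: win w => {h} [h hc|h v vh [a av] _ IH] w.
  by rewrite negb_and hc.
have [->{w}|wv] := eqVneq w v; last first.
  by apply: contra (IH a av w); exact: block_vertex_cons.
apply/negP => /andP[_ /allP blk]; case/and3P: av => _ /blk /existsP[u].
by case/andP=> vu uh /forallP/(_ u); rewrite vu uh.
Qed.

Lemma size_valid_uncolored S h v : valid S h -> uncolored h v -> size h < #|G|.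
Proof.
move=> /valid_uniq hu vh; have : uniq (v :: unzip1 h) by rewrite /= hu andbT.
by move=> /card_uniqP /= ; rewrite size_map => <-; exact: max_card.
Qed.

(** The number of uncolored vertices is the measure for inductions over rounds; the bounds have the
    shape produced by [ubnP]. *)
Lemma uncolored_decr S h v n : valid S h -> uncolored h v ->
  #|G| - size h < n.+1 -> #|G| - (size h).+1 < n.
Proof.
move=> hv vh hn; have := size_valid_uncolored hv vh.
by rewrite -subn_gt0 => lt0; rewrite subnS -ltnS prednK.
Qed.

Lemma size_complete h : (forall v, ~~ uncolored h v) -> #|G| <= size h.
Proof.
move=> hc; rewrite -(size_map fst) cardE uniq_leq_size ?enum_uniq //.
by move=> v _; rewrite -[_ \in _]negbK; exact: hc.
Qed.

Lemma complete_or_uncolored h :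
  (forall v, ~~ uncolored h v) \/ exists v, uncolored h v.
Proof.
case: (boolP [exists v, uncolored h v]) => [/existsP|/existsPn]; first by right.
by left.
Qed.

Lemma winning_ann_wins S s h : winning S s -> play S s h -> ann_wins S h.
Proof.
move=> win; have [n] := ubnP (#|G| - size h).
elim: n h => // n IH h hn ph.
have [hc|hu] := complete_or_uncolored h; first exact: AnnDone.
have [[v sv vh] nb] := win h ph hu.
apply: (AnnMove vh) => [|a av].
  by apply: ex_legal => //; apply/negP => blk; apply: nb; exists v.
apply: IH; last by rewrite /= ph sv eqxx.
exact: uncolored_decr (play_valid ph) vh hn.
Qed.

Lemma ann_wins_winning S : ann_wins S [::] -> exists s : strategy G, winning S s.
Proof.
move=> win0.
pose good h v := uncolored h v /\ forall a, legal S h v a -> ann_wins S ((v, a) :: h).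
(* Ann picks any vertex for which every legal answer leads to a winning position. By [goodP], plays
   following [s] meet the default [None] only when everything is colored. *)
have /choice[s sP] : forall h, exists o : option G,
    (exists v, good h v) -> exists2 v, o = Some v & good h v.
  move=> h; have [[v vP]|nP] := pselect (exists v, good h v); last by exists None.
  by exists (Some v) => _; exists v.
have goodP h : ann_wins S h -> (exists v, uncolored h v) -> exists v, good h v.
  case=> [hc [v]|v vh _ vP _]; first by rewrite (negPf (hc v)).
  by exists v.
have playP h : play S s h -> ann_wins S h.
  elim: h => //= -[v a] h IH /and3P[/IH wh /eqP sv av].
  have [|w] := sP h (goodP h wh _); first by exists v; case/andP: av.
  by rewrite sv => -[<-] [_]; apply.
exists s => h /playP wh hu; split.
  by have [v sv [vh _]] := sP h (goodP h wh hu); exists v.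
by case=> v; apply/negP; exact: ann_wins_no_block.
Qed.

Lemma indicated_colorableP k :
  indicated_colorable G k <-> ann_wins (iota 0 k) [::].
Proof.
split=> [[s win]|]; last exact: ann_wins_winning.
exact: (winning_ann_wins win).
Qed.

(** Letting Ben give some legal answer in each round plays the game to its end. *)
Lemma ann_wins_complete S h : ann_wins S h -> valid S h ->
  exists h', [/\ valid S h', {subset h <= h'} & forall v, ~~ uncolored h' v].
Proof.
elim=> {h} [h hc hv|h v vh [a av] _ IH hv]; first by exists h; split.
have [|h' [hv' sub hc]] := IH a av; first by rewrite /= hv.
by exists h'; split=> // p ph; apply: sub; rewrite inE ph orbT.
Qed.

Lemma chi_le_colors S h : valid S h -> (forall v, ~~ uncolored h v) ->
  chi G <= colors_used h.
Proof.
move=> hv hc; have /choice[f fP] : forall v, exists a, (v, a) \in h.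
  by move=> v; exact/uncoloredPn.
apply: (@chi_le _ _ f) => [v|u v uv]; first by rewrite mem_undup (mem_colors (fP v)).
exact: (valid_proper hv (fP u) (fP v) uv).
Qed.

End Positions.

(** Any two vertices are adjacent, so no color repeats. *)
Lemma complete_valid_uniq l S (h : history (complete_graph l)) :
  valid S h -> uniq (unzip2 h).
Proof.
elim: h => //= -[i a] h IH /andP[/IH -> /and3P[ih _ /forallP aP]] /=.
rewrite andbT; apply/mapP => -[[j b] jh /= ab]; have := aP j.
rewrite ab jh implybF /= /complete_adj negbK => /eqP ij.
by move: ih; rewrite /uncolored ij => /negP; apply; apply/mapP; exists (j, b).
Qed.

(** * The copies of the second factor in a lexicographic product *)

Section Copies.
Variables G H : sgraph.
Implicit Types (h : history (lex_product G H)) (x y : G) (v : H).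

Definition copy x h : history H := [seq (p.1.2, p.2) | p <- h & p.1.1 == x].

Lemma copy_cons x y v a h :
  copy y (((x, v), a) :: h) = if x == y then (v, a) :: copy y h else copy y h.
Proof. by rewrite /copy /=; case: eqP. Qed.

Lemma mem_copy x v a h : ((v, a) \in copy x h) = (((x, v), a) \in h).
Proof.
elim: h => //= -[[y w] b] h IH; rewrite copy_cons inE -IH.
rewrite -!pair_eqE /= -pair_eqE /= [x == y]eq_sym.
by case: eqP => //= _; rewrite inE.
Qed.

Lemma uncolored_copy x v h : uncolored (copy x h) v = uncolored h (x, v).
Proof.
apply/idP/idP; apply: contraLR => /uncoloredPn[a ah]; apply/uncoloredPn.
  by exists a; rewrite mem_copy.
by exists a; rewrite -mem_copy.
Qed.

Lemma copy_colorsP x h a :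
  reflect (exists v, ((x, v), a) \in h) (a \in unzip2 (copy x h)).
Proof.
apply: (iffP mapP) => [[[v b] vh ->]|[v vh]].
  by exists v; rewrite -mem_copy.
by exists (v, a); rewrite ?mem_copy.
Qed.

(** Adjacent copies are completely joined, so they matter only through their color sets; this lets a
    copy of [H] be exchanged for a complete graph. *)
Lemma legal_lex S h x v a : legal S h (x, v) a =
  legal S (copy x h) v a &&
  [forall y, adj x y ==> (a \notin unzip2 (copy y h))].
Proof.
rewrite /legal uncolored_copy -!andbA; congr [&& _, _ & _].
apply/forallP/andP => [vP|[/forallP uP /forallP yP] [y u]].
  split; apply/forallP => z; apply/implyP => zP.
    have := vP (x, z); rewrite /= /lex_adj /= eqxx zP /= => vz.
    by rewrite mem_copy.
  apply/copy_colorsP => -[u uh]; have := vP (z, u).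
  by rewrite /= /lex_adj /= zP orbT uh.
apply/implyP; rewrite /= /lex_adj /= => /orP[/andP[/eqP<- vu]|xy].
  by have := uP u; rewrite vu mem_copy.
by have := yP y; rewrite xy /=; apply: contra => uh; apply/copy_colorsP; exists u.
Qed.

Lemma valid_copy S x h : valid S h -> valid S (copy x h).
Proof.
elim: h => //= -[[y v] a] h IH /andP[/IH hv]; rewrite copy_cons.
by case: eqP => [->|_] //; rewrite legal_lex => /andP[lv _]; rewrite /= hv.
Qed.

Lemma valid_copy_adj S x y h a : valid S h -> adj x y ->
  a \in unzip2 (copy x h) -> a \notin unzip2 (copy y h).
Proof.
move=> hv xy /copy_colorsP[v vh]; apply/copy_colorsP => -[w wh].
have /(_ _)/eqP := valid_proper hv vh wh; apply=> //.
by rewrite /= /lex_adj /= xy orbT.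
Qed.

End Copies.

(** * From G[H] to G[K_l] *)

Lemma chi_surj (H : sgraph) (f : H -> 'I_(chi H)) :
  (forall u v, adj u v -> f u != f v) -> forall i, exists v, f v = i.
Proof.
move=> fP i; have [//|nP] := pselect (exists v, f v = i).
have : chi H <= size (enum (predC1 i)).
  apply: (@chi_le H _ f _ _ fP) => v.
  by rewrite mem_enum inE; apply/eqP => vi; apply: nP; exists v.
rewrite -cardE cardC1 card_ord -ltnS prednK ?ltnn //.
exact: leq_ltn_trans (ltn_ord i).
Qed.

Lemma ann_wins_lex_complete (G H : sgraph) S :
  ann_wins S ([::] : history (lex_product G H)) ->
  ann_wins S ([::] : history (lex_product G (complete_graph (chi H)))).
Proof.
have /existsP[f0 /forallP fP0] := chi_colorable H.
pose f : H -> complete_graph (chi H) := f0.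
have fP u v : adj u v -> f u != f v.
  by move=> uv; have /forallP/(_ v)/implyP/(_ uv) := fP0 u.
have f_surj := chi_surj fP.
(* Invariant between the imaginary position [h] and the real position [k]: the same colors over each
   vertex of [G], and [(x, v)] colored like [(x, f v)]. *)
suff step (h : history (lex_product G H)) : ann_wins S h ->
    forall k : history (lex_product G (complete_graph (chi H))),
    valid S h -> valid S k ->
    (forall x, unzip2 (copy x h) =i unzip2 (copy x k)) ->
    (forall x v a, (v, a) \in copy x h -> (f v, a) \in copy x k) ->
    ann_wins S k.
  by move=> win; apply: (step _ win).
elim=> {h} [h hc|h [x v] vh ex sub IH] k hv kv hk fk.
  apply: AnnDone => -[x i]; have [v <-] := f_surj i.
  have := hc (x, v); rewrite -!uncolored_copy => /uncoloredPn[a ah].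
  by apply/uncoloredPn; exists a; exact: fk.
have legal_h a : a \in S -> (forall u, adj v u -> (f u, a) \notin copy x k) ->
    (forall y, adj x y -> a \notin unzip2 (copy y k)) -> legal S h (x, v) a.
  move=> aS uP yP; rewrite legal_lex /legal uncolored_copy vh aS /=.
  apply/andP; split; apply/forallP => z; apply/implyP => zP.
    by apply: contra (uP z zP) => /fk.
  by rewrite hk yP.
case: (boolP (uncolored k (x, f v))) => [fv|].
  apply: (AnnMove fv) => [|a].
    have [[a [aS ak yP]]|nP] := pselect (exists a, [/\ a \in S,
        a \notin unzip2 (copy x k) &
        forall y, adj x y -> a \notin unzip2 (copy y k)]).
      exists a; rewrite legal_lex legal_fresh ?uncolored_copy // aS.
      by apply/forallP => y; apply/implyP; exact: yP.
    (* No free color: when the imaginary game is finished, the copy over [x] has only colors that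
       [k] already uses there. They are fewer than [chi H], as [(x, f v)] is uncolored. *)
    have [h' [hv' sub' hc']] := ann_wins_complete (AnnMove vh ex sub) hv.
    have hvx := valid_copy x hv'; have hx w : ~~ uncolored (copy x h') w.
      by rewrite uncolored_copy.
    have lt : size (unzip2 (copy x k)) < chi H.
      rewrite size_map -[X in _ < X]card_ord.
      by apply: (size_valid_uncolored (valid_copy x kv) (v := f v)); rewrite uncolored_copy.
    have := chi_le_colors hvx hx; rewrite leqNgt (leq_ltn_trans _ lt) //.
    apply: uniq_leq_size (undup_uniq _) _ => a; rewrite mem_undup => ax.
    apply: contra_notT nP => ak; exists a; split=> // [|y xy].
      exact: valid_colors hvx _ ax.
    rewrite -hk; apply: contra (valid_copy_adj hv' xy ax) => /copy_colorsP[w wh].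
    by apply/copy_colorsP; exists w; exact: sub'.
  move=> fa; have := fa; rewrite legal_lex => /andP[/and3P[_ aS /forallP uP] /forallP yP].
  have ha : legal S h (x, v) a.
    apply: legal_h => // [u vu|y xy]; last by have := yP y; rewrite xy.
    by have := uP (f u); rewrite /= /complete_adj fP.
  apply: (IH a ha); rewrite /= ?hv ?kv //.
    by move=> y b; rewrite !copy_cons; case: eqP => _; rewrite ?inE hk.
  move=> y w b; rewrite !copy_cons; case: eqP => _; last exact: fk.
  by rewrite !inE => /predU1P[[-> ->]|/fk ->]; rewrite ?eqxx ?orbT.
(* If [(x, f v)] is already colored, its color answers the imaginary move and the real game does not
   advance. *)
rewrite -uncolored_copy => /uncoloredPn[a ak]; have kvx := valid_copy x kv.
have ax := mem_colors ak; have ha : legal S h (x, v) a.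
  apply: legal_h => [|u vu|y xy]; first exact: valid_colors kvx _ ax.
    apply/negP => uk; have /(_ _)/eqP := valid_proper kvx ak uk; apply=> //.
    by rewrite /= /complete_adj fP.
  exact: valid_copy_adj kv xy ax.
apply: (IH a ha) => //=; first by rewrite hv.
  move=> y b; rewrite copy_cons; case: eqP => [<-|_]; last exact: hk.
  by rewrite inE hk; case: eqP => // ->.
move=> y w b; rewrite copy_cons; case: eqP => [<-|_]; last exact: fk.
by rewrite inE => /predU1P[[-> ->]|/fk].
Qed.

(** * From G[K_l] to G[H], by the strategy of the family *)

Section FollowFamily.
Variables (G H : sgraph) (s : strategy H).
Hypothesis s_extends : forall (k : nat) (T : seq nat),
  chi_i H <= k -> uniq T -> size T = k ->
  exists t : strategy H, winning T t /\
    (forall h, play T t h -> colors_used h < chi_i H -> t h = s h).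

(** No color set is mentioned: which colors a copy may use is known only once the adjacent copies
    have received theirs. *)
Fixpoint follows (h : history H) :=
  if h is (v, a) :: h' then
    [&& follows h', s h' == Some v & colors_used h' < chi_i H]
  else true.

Lemma valid_sub S T (h : history H) :
  valid S h -> {subset unzip2 h <= T} -> valid T h.
Proof.
elim: h => //= -[v a] h IH /andP[hv /and3P[vh _ aP]] sub.
rewrite /legal vh aP sub ?inE ?eqxx // !andbT IH // => b bh.
by rewrite sub // inE bh orbT.
Qed.

(** Each move of [h] was made with fewer than [chi_i H] colors used, where [t] and [s] agree. *)
Lemma follows_play T t h :
  (forall h, play T t h -> colors_used h < chi_i H -> t h = s h) ->
  valid T h -> follows h -> play T t h.
Proof.
move=> ts; elim: h => //= -[v a] h IH /andP[hv av] /and3P[fh /eqP sv lt].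
by have ph := IH hv fh; rewrite ph ts // sv eqxx.
Qed.

Lemma follows_next S h : chi H = chi_i H ->
  valid S h -> follows h -> colors_used h < chi_i H ->
  exists2 v, s h = Some v & uncolored h v.
Proof.
(* The colors of [h] are padded to at least [chi_i H] colors, so that some extension [t] of [s]
   applies. It still has a vertex to select, as a complete coloring needs [chi H] colors. *)
move=> chiE hv fh lt; pose T := undup (unzip2 h ++ iota 0 (chi_i H)).
have le : chi_i H <= size T.
  rewrite -{1}(size_iota 0 (chi_i H)) uniq_leq_size ?iota_uniq // => a aI.
  by rewrite mem_undup mem_cat aI orbT.
have [t [win ts]] := s_extends le (undup_uniq _) erefl.
have hT : valid T h.
  by apply: (valid_sub hv) => a ah; rewrite mem_undup mem_cat ah.
have ph := follows_play ts hT fh; rewrite -ts //.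
have [hc|hu] := complete_or_uncolored h; last by have [] := win h ph hu.
by have := chi_le_colors hv hc; rewrite chiE leqNgt lt.
Qed.

Implicit Types h : history (lex_product G H).

(** Moves over [x] leave the adjacent copies unchanged, so [T] remains the set of colors they allow
    and the game over [x] is the game on [H] with color set [T]. The last premise is the
    continuation after this copy. *)
Lemma ann_wins_finish_copy S (t : strategy H) (T : seq nat) x h :
  winning T t -> play T t (copy x h) -> valid S h ->
  (forall a, (a \in T) = (a \in S) &&
     [forall y, adj x y ==> (a \notin unzip2 (copy y h))]) ->
  (forall h', valid S h' -> (forall v, ~~ uncolored h' (x, v)) ->
     (forall y, y != x -> copy y h' = copy y h) -> ann_wins S h') ->
  ann_wins S h.
Proof.
move=> win; have [n] := ubnP (#|lex_product G H| - size h).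
elim: n h => // n IH h hn ph hv hT fin.
have [hc|hu] := complete_or_uncolored (copy x h).
  by apply: fin => // v; rewrite -uncolored_copy.
have [[v tv vh] nb] := win _ ph hu.
have xv : uncolored h (x, v) by rewrite -uncolored_copy.
have legalE a : legal S h (x, v) a = legal T (copy x h) v a.
  by rewrite legal_lex /legal hT -!andbA; congr (_ && (_ && _)); rewrite andbC.
apply: (AnnMove xv) => [|a av].
  have [|a av] := ex_legal (S := T) _ vh; last by exists a; rewrite legalE.
  by apply/negP => blk; apply: nb; exists v.
have copyE y : y != x -> copy y (((x, v), a) :: h) = copy y h.
  by rewrite copy_cons eq_sym; case: eqP.
apply: IH => [||/=|b|h' hv' hc' h'E].
- exact: uncolored_decr hv xv hn.
- by rewrite copy_cons eqxx /= ph tv eqxx -/(legal _ _ _ _) -legalE.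
- by rewrite hv.
- rewrite hT; congr (_ && _); apply: eq_forallb => y.
  by have [->|yx] := eqVneq y x; rewrite ?adj_irr // copyE.
- by apply: fin => // y yx; rewrite h'E // copyE.
Qed.

Lemma ann_wins_finish S (xs : seq G) h : uniq S -> valid S h ->
  (forall x, x \notin xs -> forall v, ~~ uncolored h (x, v)) ->
  (forall x, x \in xs -> follows (copy x h) /\
     chi_i H <= colors_used (copy x h)) ->
  uniq xs -> ann_wins S h.
Proof.
move=> uS; elim: xs h => [|x xs IH] h hv hc hf.
  by move=> _; apply: AnnDone => -[x v]; exact: hc.
case/andP=> xxs uxs; have [fx le] := hf x (mem_head _ _).
(* [T] contains the colors already present over [x], hence at least [chi_i H] colors. *)
pose T := [seq a <- S | [forall y, adj x y ==> (a \notin unzip2 (copy y h))]].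
have hT a : (a \in T) = (a \in S) &&
     [forall y, adj x y ==> (a \notin unzip2 (copy y h))].
  by rewrite mem_filter andbC.
have sub : {subset unzip2 (copy x h) <= T}.
  move=> a ax; rewrite hT (valid_colors (valid_copy x hv) ax) /=.
  by apply/forallP => y; apply/implyP => xy; exact: valid_copy_adj hv xy ax.
have leT : chi_i H <= size T.
  apply: leq_trans le (uniq_leq_size (undup_uniq _) _) => a.
  by rewrite mem_undup => /sub.
have [t [win ts]] := s_extends leT (filter_uniq _ uS) erefl.
have ph := follows_play ts (valid_sub (valid_copy x hv) sub) fx.
apply: (ann_wins_finish_copy win ph hv hT) => h' hv' hcx h'E.
apply: IH => // y yxs.
  have [->//|yx] := eqVneq y x; move=> v.
  rewrite -uncolored_copy h'E // uncolored_copy; apply: hc.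
  by rewrite inE negb_or yx.
have yx : y != x by apply: contraTneq yxs => ->.
by rewrite h'E //; apply: hf; rewrite inE yxs orbT.
Qed.

Lemma ann_wins_lex_family S : uniq S -> chi H = chi_i H ->
  ann_wins S ([::] : history (lex_product G (complete_graph (chi_i H)))) ->
  ann_wins S ([::] : history (lex_product G H)).
Proof.
move=> uS chiE.
suff step (k : history (lex_product G (complete_graph (chi_i H)))) :
    ann_wins S k -> forall h, valid S k -> valid S h ->
    (forall x, unzip2 (copy x k) =i unzip2 (copy x h)) ->
    (forall x, follows (copy x h)) -> ann_wins S h.
  by move=> win; apply: (step _ win).
(* Colors in a copy of the complete graph are distinct, so counting its colored vertices counts the
   colors in the copy of [H]. *)
have colorsE (m : history (lex_product G (complete_graph (chi_i H)))) h x :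
    valid S m -> unzip2 (copy x m) =i unzip2 (copy x h) ->
    colors_used (copy x h) = size (copy x m).
  move=> mv mh; rewrite -(size_map snd); apply/esym/perm_size/uniq_perm.
  - exact: complete_valid_uniq (valid_copy x mv).
  - exact: undup_uniq.
  - by move=> a; rewrite mem_undup mh.
elim=> {k} [k kc|k [x i] ik [a ia] _ IH] h kv hv kh hf.
  apply: (@ann_wins_finish S (enum G)); rewrite ?enum_uniq // => x.
    by rewrite mem_enum.
  move=> _; split; first exact: hf.
  rewrite (colorsE k) // -[X in X <= _]card_ord.
  by apply: (size_complete (G := complete_graph _)) => i; rewrite uncolored_copy.
have lt : size (copy x k) < chi_i H.
  rewrite -[X in _ < X]card_ord.
  by apply: (size_valid_uncolored (valid_copy x kv) (v := i)); rewrite uncolored_copy.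
(* Inner induction for the rounds in which Ben repeats a color of the copy: [h] grows while [k]
   stays. *)
have [n] := ubnP (#|lex_product G H| - size h).
elim: n h hv kh hf => // n IHn h hv kh hf hn.
have cx : colors_used (copy x h) < chi_i H by rewrite (colorsE k).
have [v sv vh] := follows_next chiE (valid_copy x hv) (hf x) cx.
have xv : uncolored h (x, v) by rewrite -uncolored_copy.
have legalE b : b \notin unzip2 (copy x k) ->
    legal S k (x, i) b = legal S h (x, v) b.
  move=> bk; rewrite !legal_lex !legal_fresh ?uncolored_copy -?kh //.
  by congr (_ && _); apply: eq_forallb => y; rewrite kh.
have followsP b y : follows (copy y (((x, v), b) :: h)).
  by rewrite copy_cons; case: eqP => [<-|_] //=; rewrite hf sv eqxx.
apply: (AnnMove xv) => [|b bv].
  (* A color legal at [(x, i)] is new to the copy over [x], since [(x, i)] is adjacent to the rest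
     of it; hence it is legal at [(x, v)] too. *)
  exists a; rewrite -legalE //; apply/copy_colorsP => -[j jk].
  have [ij|ij] := eqVneq i j.
    by move: ik; rewrite ij => /negP; apply; apply/mapP; exists ((x, j), a).
  case/and3P: ia => _ _ /forallP/(_ (x, j)).
  by rewrite jk /= /lex_adj /= eqxx /complete_adj ij.
have hvb : @valid (lex_product G H) S (((x, v), b) :: h) by rewrite /= hv.
case: (boolP (b \in unzip2 (copy x k))) => [bk|bk]; last first.
  (* A new color is passed on to [(x, i)], and the game on G[K_l] advances. *)
  have ib : legal S k (x, i) b by rewrite legalE.
  apply: (IH b ib) => //=; first by rewrite kv.
  by move=> y c; rewrite !copy_cons; case: eqP => _ /=; rewrite ?inE kh.
apply: IHn => //.
  move=> y c; rewrite copy_cons; case: eqP => [<-|_] /=; last exact: kh.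
  by rewrite inE -kh; case: eqP => // ->.
exact: uncolored_decr hv xv hn.
Qed.

End FollowFamily.

Theorem theorem2p3 (G H : sgraph) (l : nat)
    (hH : family_H H) (hchi : chi H = l) (hchi_i : chi_i H = l) :
  (forall k : nat,
     indicated_colorable (lex_product G H) k <->
     indicated_colorable (lex_product G (complete_graph l)) k) /\
  chi_i (lex_product G H) = chi_i (lex_product G (complete_graph l)).
Proof.
have equiv k : indicated_colorable (lex_product G H) k <->
    indicated_colorable (lex_product G (complete_graph l)) k.
  rewrite !indicated_colorableP; split.
    by rewrite -hchi; exact: ann_wins_lex_complete.
  have [s [_ s_extends]] := hH; rewrite -hchi_i.
  by apply: (ann_wins_lex_family s_extends); rewrite ?iota_uniq // hchi_i.
split=> //; rewrite /chi_i; apply: eq_ex_minn => k.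
by apply/asboolP/asboolP => /equiv.
Qed.
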